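(* Let the $q$-hypergeometric Bernoulli numbers $\mathcal B_{N,n}$ be defined by $\sum_{n=0}^\infty\mathcal B_{N,n}\frac{x^n}{n!}=\left(\sum_{j=0}^\infty\frac{[N]_q!}{[N+j]_q!}x^j\right)^{-1}$. For all integers $N,n\ge 1$, $$\mathcal B_{N,n}=(-1)^n n!\begin{vmatrix} \frac{[N]_q!}{[N+1]_q!}&1&0&&\\ \frac{[N]_q!}{[N+2]_q!}&\frac{[N]_q!}{[N+1]_q!}&1&&\\ \vdots&\vdots&\ddots&1&0\\ \frac{[N]_q!}{[N+n-1]_q!}&\frac{[N]_q!}{[N+n-2]_q!}&\cdots&\frac{[N]_q!}{[N+1]_q!}&1\\ \frac{[N]_q!}{[N+n]_q!}&\frac{[N]_q!}{[N+n-1]_q!}&\cdots&\frac{[N]_q!}{[N+2]_q!}&\frac{[N]_q!}{[N+1]_q!} \end{vmatrix},$$ where the $n\times n$ matrix has $(i,j)$ entry $\frac{[N]_q!}{[N+i-j+1]_q!}$ if $i\ge j$, $1$ if $j=i+1$, and $0$ if $j>i+1$.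
   Context: $q\ne 1$ is a complex number that is not a root of unity; $[n]_q=\frac{1-q^n}{1-q}$, $[n]_q!=[n]_q[n-1]_q\cdots[1]_q$ for $n\ge1$, and $[0]_q!=1$. Generating functions are formal power series in $x$. *)

(* Defs.v *)
From HB Require Import structures.
From mathcomp Require Import all_boot all_order all_algebra.
From mathcomp Require Import reals complex.

Set Implicit Arguments.
Unset Strict Implicit.
Unset Printing Implicit Defensive.

Import GRing.Theory Num.Theory.
Local Open Scope ring_scope.

Section FormalPowerSeries.
Variable C : fieldType.
Implicit Types f g h : nat -> C.

(* A formal power series is represented by its sequence of coefficients. *)
Definition fps_mul f g : nat -> C :=
  fun n => \sum_(i < n.+1) f i * g (n - i)%N.

Definition fps_one : nat -> C := fun n => (n == 0%N)%:R.

Definition fps_inverse f g : Prop := fps_mul f g =1 fps_one.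

Lemma fps_inverse_ex f : f 0%N = 1 -> exists g, fps_inverse f g.
Proof.
move=> f0.
pose fix rs n : seq C := if n is m.+1
  then (- \sum_(i < m.+1) f i.+1 * nth 0 (rs m) i) :: rs m else [:: 1].
pose g n := head 0 (rs n).
have rsE m i : (i <= m)%N -> nth 0 (rs m) i = g (m - i)%N.
  elim: m i => [|m IH] [|i] //= im; by rewrite subSS -IH.
exists g => -[|n]; rewrite /fps_mul /fps_one big_ord_recl /= f0 mul1r.
  by rewrite big_ord0 addr0.
rewrite subn0 {1}/g /= -[RHS](addNr (\sum_(i < n.+1) f i.+1 * nth 0 (rs n) i)).
congr (_ + _); apply: eq_bigr => i _.
by rewrite /bump /= add1n subSS rsE // -ltnS.
Qed.

Lemma fps_inverse_uniq f g h :
  f 0%N = 1 -> fps_inverse f g -> fps_inverse f h -> g =1 h.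
Proof.
move=> f0 fg fh n; elim/ltn_ind: n => n IH.
have := fg n; rewrite -(fh n) /fps_mul !big_ord_recl /= f0 !mul1r subn0.
rewrite (eq_bigr (fun i : 'I_n => f (bump 0 i) * h (n - bump 0 i)%N)).
  exact: addIr.
move=> i _; rewrite IH // /bump /= add1n ltn_subrL /=.
exact: leq_ltn_trans (ltn_ord i).
Qed.

End FormalPowerSeries.

Section QHypergeometricBernoulli.
Variable C : numFieldType.
Implicit Types (q : C) (N n : nat) (B : nat -> C).

Definition qint q n : C := (1 - q ^+ n) / (1 - q).

Definition qfact q n : C := \prod_(1 <= k < n.+1) qint q k.

Definition qfact_ratio q N j : C := qfact q N / qfact q (N + j)%N.

(* [B] has as exponential generating function the inverse of the series with
   coefficients [qfact_ratio q N]; this determines [B]. *)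
Definition is_qhBernoulli q N B : Prop :=
  fps_inverse (qfact_ratio q N) (fun n => B n / n`!%:R).

(* Indices start at 0, which does not affect [i - j + 1]. *)
Definition qhBernoulli_mx q N n : 'M[C]_n :=
  \matrix_(i < n, j < n)
    if (j <= i)%N then qfact_ratio q N (i - j + 1)
    else if j == i.+1 :> nat then 1 else 0.

Lemma qfact_neq0 q n : q != 1 -> (forall k, (0 < k)%N -> ~~ k.-unity_root q) ->
  qfact q n != 0.
Proof.
move=> q1 qP; rewrite /qfact prodf_seq_neq0; apply/allP => k.
rewrite mem_index_iota => /andP[k0 _] /=.
rewrite mulf_neq0 ?invr_eq0 // subr_eq0 eq_sym //.
by have := qP k k0; rewrite unity_rootE.
Qed.

Lemma qfact_ratio0 q N :
  q != 1 -> (forall k, (0 < k)%N -> ~~ k.-unity_root q) ->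
  qfact_ratio q N 0 = 1.
Proof. by move=> q1 qP; rewrite /qfact_ratio addn0 divff ?qfact_neq0. Qed.

Lemma qhBernoulli_ex q N :
  q != 1 -> (forall k, (0 < k)%N -> ~~ k.-unity_root q) ->
  exists B, is_qhBernoulli q N B.
Proof.
move=> q1 qP; have [g gP] := fps_inverse_ex (qfact_ratio0 N q1 qP).
exists (fun n => g n * n`!%:R) => n; rewrite -gP; apply: eq_bigr => i _.
by rewrite mulfK // pnatr_eq0 -lt0n fact_gt0.
Qed.

Lemma qhBernoulli_uniq q N B B' :
  q != 1 -> (forall k, (0 < k)%N -> ~~ k.-unity_root q) ->
  is_qhBernoulli q N B -> is_qhBernoulli q N B' -> B =1 B'.
Proof.
move=> q1 qP BP BP' n.
have /(_ n)/divIf := fps_inverse_uniq (qfact_ratio0 N q1 qP) BP BP'.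
by apply; rewrite pnatr_eq0 -lt0n fact_gt0.
Qed.

End QHypergeometricBernoulli.

(* Main.v *)
Require Import Defs.
From mathcomp Require Import all_boot all_order all_algebra.
From mathcomp Require Import reals complex.
Import GRing.Theory Num.Theory.
Local Open Scope ring_scope.

(** Multiplication by a power series [f] truncated at order [n] is a lower
    triangular Toeplitz matrix [T], of determinant 1 as soon as [f 0 = 1].
    If [g] is the inverse of [f], then [T] sends the column of the first [n + 1]
    coefficients of [g] to the first basis vector, so Cramer's rule, in the form
    [\adj T *m T = (\det T)%:M], shows that [g n] is an entry of the adjugate of
    [T] ([fps_inverse_cofactor]): up to the sign [(-1) ^+ n], the minor of [T]
    that omits the first row and the last column.  Omitting the first row shifts
    the diagonal of ones of [T] to the superdiagonal, so for
    [f = qfact_ratio q N] this minor is the Hessenberg determinant of the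
    theorem; [g n] is then the Bernoulli number divided by [n!]. *)

Definition fps_toeplitz {F : fieldType} (f : nat -> F) (n : nat) : 'M[F]_n :=
  \matrix_(i < n, j < n) if (j <= i)%N then f (i - j)%N else 0.

Lemma det_fps_toeplitz {F : fieldType} (f : nat -> F) (n : nat) :
  f 0%N = 1 -> \det (fps_toeplitz f n) = 1.
Proof.
move=> f0; rewrite det_trig.
  by apply: big1 => i _; rewrite mxE leqnn subnn.
by apply/is_trig_mxP => i j ij; rewrite mxE leqNgt ij.
Qed.

Lemma mul_fps_toeplitz (F : fieldType) (f g : nat -> F) (n : nat) :
  fps_toeplitz f n *m (\col_(j < n) g j) = \col_(i < n) fps_mul f g i.
Proof.
apply/matrixP => i k; rewrite !mxE /fps_mul.
under eq_bigr => j _ do rewrite !mxE.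
(* Column [j > i] contributes nothing; the rest is the Cauchy product with
   its two factors read in the opposite order. *)
rewrite -(big_mkord xpredT
  (fun j => (if (j <= i)%N then f (i - j)%N else 0) * g j)).
rewrite (big_cat_nat (n := i.+1)) //= [X in _ + X]big_nat_cond.
rewrite [X in _ + X]big1 ?addr0; last first.
  by move=> j /andP[/andP[ij _] _]; rewrite leqNgt ij mul0r.
rewrite big_mkord (reindex_inj rev_ord_inj) /=; apply: eq_bigr => j _.
by rewrite subSS leq_subr subKn // -ltnS.
Qed.

(** Cramer's rule for the triangular system that determines the coefficients of
    [g].  Size [n + 1] is the smallest in which [g n] is an unknown, and there it
    is the last one, whence the column [ord_max]; the right-hand side is the
    first basis vector, whence the row [ord0]. *)
Lemma fps_inverse_cofactor {F : fieldType} {f g : nat -> F} (n : nat) :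
    f 0%N = 1 -> fps_inverse f g ->
  g n = cofactor (fps_toeplitz f n.+1) ord0 ord_max.
Proof.
move=> f0 fg; set T := fps_toeplitz f n.+1.
have Tg : T *m (\col_j g j) = delta_mx ord0 ord0 :> 'cV_n.+1.
  rewrite mul_fps_toeplitz; apply/matrixP => i j.
  by rewrite !mxE fg /fps_one ord1 andbT.
have : \adj T *m (T *m (\col_j g j)) = \col_j g j.
  by rewrite mulmxA mul_adj_mx det_fps_toeplitz // mul1mx.
by rewrite Tg -colE => /matrixP/(_ ord_max ord0); rewrite !mxE.
Qed.

(** Row [i] of the minor is row [i + 1] of the Toeplitz matrix, so its
    superdiagonal carries the constant coefficient [qfact_ratio q N 0]. *)
Lemma qhBernoulli_mx_minor (F : numFieldType) (q : F) (N n : nat) :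
    qfact_ratio q N 0 = 1 ->
  row' ord0 (col' ord_max (fps_toeplitz (qfact_ratio q N) n.+1))
    = qhBernoulli_mx q N n.
Proof.
move=> r0; apply/matrixP => i j.
rewrite !mxE lift_max lift0 addn1.
case: (ltngtP j i.+1) => [ji|ij|->].
- by rewrite -ltnS ji subSn.
- by rewrite leqNgt ltnW.
- by rewrite ltnn subnn.
Qed.

Theorem theorem3 (R : realType) (q : R[i])
  (q_neq1 : q != 1)
  (q_not_root_of_unity : forall k : nat, (0 < k)%N -> ~~ k.-unity_root q)
  (B : nat -> nat -> R[i])
  (B_def : forall N : nat, (1 <= N)%N -> is_qhBernoulli q N (B N))
  (N n : nat) (N_ge1 : (1 <= N)%N) (n_ge1 : (1 <= n)%N) :
  B N n = (-1) ^+ n * n`!%:R * \det (qhBernoulli_mx q N n).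
Proof.
have r0 := qfact_ratio0 N q_neq1 q_not_root_of_unity.
have nf0 : n`!%:R != 0 :> R[i] by rewrite pnatr_eq0 -lt0n fact_gt0.
have := fps_inverse_cofactor n r0 (B_def N N_ge1).
rewrite /cofactor qhBernoulli_mx_minor // add0n => /(canRL (divfK nf0)) ->.
by rewrite mulrAC.
Qed.
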